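(* Let $n\ge 2$ be an integer and let $R_n$ be the $n\times n$ tridiagonal matrix whose subdiagonal entries are all $-1$, whose superdiagonal entries are all $1$, whose diagonal is $(-1,0,0,\dots,0,0,1)$ (that is, the $(1,1)$ entry is $-1$, the $(n,n)$ entry is $1$, and all other diagonal entries are $0$), and whose other entries are all $0$. Put $\theta:=\pi/n$. Then the eigenvalues of $R_n$ (over $\mathbb{C}$, listed with algebraic multiplicity) are the $n$ numbers $0$ and $2i\cos(j\theta)$ for $j=1,\dots,n-1$.
   Context: Here $i$ denotes the imaginary unit. For $n=2$ the matrix is $R_2=\begin{pmatrix}-1&1\\-1&1\end{pmatrix}$; for $n=4$ it is $R_4=\begin{pmatrix}-1&1&0&0\\-1&0&1&0\\0&-1&0&1\\0&0&-1&1\end{pmatrix}$. *)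

(* Defs.v *)
From mathcomp Require Import all_boot all_order all_algebra.
From mathcomp Require Export complex.
From mathcomp Require Export reals trigo.
Set Implicit Arguments.
Unset Strict Implicit.
Unset Printing Implicit Defensive.
Import Order.TTheory GRing.Theory Num.Theory.
Local Open Scope ring_scope.

(* Indices are 0-based: row 0 is the first row, row n - 1 the last one. *)
Definition R_mx (K : pzRingType) (n : nat) : 'M[K]_n :=
  \matrix_(i < n, j < n)
    if i == j :> nat then
      if i == 0%N :> nat then -1 else if i == n.-1 :> nat then 1 else 0
    else if i == j.+1 :> nat then -1
    else if j == i.+1 :> nat then 1
    else 0.

Definition algebraic_multiplicity (F : fieldType) (n : nat) (A : 'M[F]_n)
    (a : F) : nat :=
  mup a (char_poly A).

(* s may contain repetitions: each value has to occur in it exactly as often as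
   its algebraic multiplicity as an eigenvalue of A. *)
Definition lists_eigenvalues (F : fieldType) (n : nat) (A : 'M[F]_n)
    (s : seq F) : Prop :=
  forall a : F,
    (a \in s <-> eigenvalue A a) /\ count_mem a s = algebraic_multiplicity A a.

(* Main.v *)
(** Expanding along the first row, tridiagonal determinants satisfy a three-term
    recurrence, which gives [char_poly R_n = 'X * F_n] for the Fibonacci
    polynomials [F_(k+2) = 'X * F_(k+1) + F_k].  The substitution
    [x = 2 i cos t] turns [F_n] into [i^(n-1) sin (n t) / sin t], so the
    [n - 1] distinct numbers [2 i cos (j pi / n)] are all the roots of [F_n].
    Zero is counted twice when [n] is even, since then [cos (pi / 2)] occurs. *)
Require Import Defs.
From mathcomp Require Import all_boot all_order all_algebra.
From mathcomp Require Import complex reals trigo.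
From mathcomp Require Import ring.
Import Order.TTheory GRing.Theory Num.Theory.
Local Open Scope ring_scope.
Local Open Scope complex_scope.

(** The coefficients are sequences on [nat], so that deleting leading rows and columns amounts to
    composing with [succn]. *)
Definition tridiag_mx (K : pzRingType) (a b c : nat -> K) (n : nat) : 'M[K]_n :=
  \matrix_(i < n, j < n)
    if i == j :> nat then a i
    else if i == j.+1 :> nat then c j
    else if j == i.+1 :> nat then b i
    else 0.

Lemma det_tridiag_mx0 (K : comPzRingType) (a b c : nat -> K) :
  \det (tridiag_mx K a b c 0) = 1.
Proof. exact: det_mx00. Qed.

Lemma det_tridiag_mx1 (K : comPzRingType) (a b c : nat -> K) :
  \det (tridiag_mx K a b c 1) = a 0.
Proof. by rewrite det_mx11 mxE. Qed.

Lemma det_tridiag_mx_rec (K : comPzRingType) (a b c : nat -> K) (n : nat) :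
  \det (tridiag_mx K a b c n.+2) =
    a 0 * \det (tridiag_mx K (a \o succn) (b \o succn) (c \o succn) n.+1)
    - b 0 * c 0 * \det (tridiag_mx K (a \o succn \o succn) (b \o succn \o succn)
                                   (c \o succn \o succn) n).
Proof.
rewrite (expand_det_row _ ord0) !big_ord_recl big1 ?addr0; last first.
  by move=> i _; rewrite mxE /= mul0r.
rewrite !mxE /= /cofactor /= /bump /= addn0 add0n expr0 mul1r -mulrA -mulrN.
congr (_ * \det _ + b 0 * _).
  by apply/matrixP=> i j; rewrite !mxE /= /bump /= !add1n !eqSS.
(* The minor of [b 0] has [c 0] as the only nonzero entry of its first column. *)
rewrite (expand_det_col _ ord0) big_ord_recl big1 ?addr0; last first.
  by move=> i _; rewrite !mxE /= mul0r.
rewrite !mxE /= /cofactor /= addn0 expr0 expr1 mul1r mulN1r.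
congr (- (c 0 * \det _)).
by apply/matrixP=> i j; rewrite !mxE /= /bump /= !add1n !eqSS.
Qed.

Fixpoint fib_poly (K : nzRingType) (n : nat) : {poly K} :=
  if n is m.+1 then
    if m is k.+1 then 'X * fib_poly K m + fib_poly K k else 1
  else 0.
Arguments fib_poly : simpl never.

Lemma fib_poly0 (K : nzRingType) : fib_poly K 0 = 0.
Proof. by []. Qed.

Lemma fib_poly1 (K : nzRingType) : fib_poly K 1 = 1.
Proof. by []. Qed.

Lemma fib_polySS (K : nzRingType) (n : nat) :
  fib_poly K n.+2 = 'X * fib_poly K n.+1 + fib_poly K n.
Proof. by []. Qed.

Lemma monic_size_fib_poly (K : nzRingType) (n : nat) :
  (fib_poly K n.+1 \is monic) && (size (fib_poly K n.+1) == n.+1).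
Proof.
(* The bound on the preceding polynomial makes ['X * fib_poly K n.+1] dominate the sum in the
   induction step. *)
suff [//] : (fib_poly K n.+1 \is monic) && (size (fib_poly K n.+1) == n.+1)
  /\ (size (fib_poly K n) <= n)%N.
elim: n => [|n [/andP[mon /eqP sz] szn]].
  by rewrite fib_poly1 fib_poly0 monic1 size_poly1 size_poly0.
have szX : size ('X * fib_poly K n.+1) = n.+2.
  by rewrite size_monicM ?monicX ?size_polyX ?sz ?monic_neq0.
have lt : (size (fib_poly K n) < size ('X * fib_poly K n.+1)%R)%N.
  by rewrite szX ltnS (leq_trans szn).
rewrite fib_polySS size_polyDl // szX eqxx andbT sz; split=> //.
by rewrite monicE lead_coefDl // -monicE monicMl ?monicX.
Qed.

(* Deleting the first row and column of R_n leaves a matrix whose only nonzero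
   diagonal entry is the last one. *)
Lemma det_tridiag_corner (K : comNzRingType) (m : nat) :
  \det (tridiag_mx {poly K} (fun i => if i.+1 == m then 'X - 1 else 'X)
          (fun=> -1) (fun=> 1) m) =
  fib_poly K m.+1 - fib_poly K m.
Proof.
set d := fun m => \det (tridiag_mx {poly K}
  (fun i => if i.+1 == m then 'X - 1 else 'X) (fun=> -1) (fun=> 1) m).
suff: d m = fib_poly K m.+1 - fib_poly K m /\
      d m.+1 = fib_poly K m.+2 - fib_poly K m.+1 by case.
elim: m => [|n [IHn IHSn]].
  by rewrite /d det_tridiag_mx0 det_tridiag_mx1 /= fib_polySS fib_poly1 fib_poly0; split; ring.
(* The shift by [succn] keeps the special entry in the last position, and $-bc = 1$, so [d] obeys
   the Fibonacci recurrence. *)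
split=> //; rewrite {1}/d det_tridiag_mx_rec /= -/(d n) -/(d n.+1) IHn IHSn.
rewrite !fib_polySS; ring.
Qed.

(** Writing $F_k$ for [fib_poly K k], one expansion leaves two corner determinants, and
    $(X+1)(F_{m+2}-F_{m+1}) + (F_{m+1}-F_m)$ collapses to $X F_{m+2}$. *)
Lemma char_poly_R_mx (K : comNzRingType) (m : nat) :
  char_poly (R_mx K m.+2) = 'X * fib_poly K m.+2.
Proof.
have -> : char_poly (R_mx K m.+2) = \det (tridiag_mx {poly K}
    (fun i => if i == 0%N then 'X + 1 else if i == m.+1 then 'X - 1 else 'X)
    (fun=> -1) (fun=> 1) m.+2).
  congr (\det _); apply/matrixP=> i j; rewrite !mxE -val_eqE /=.
  have [_|_] := eqVneq (i : nat) j.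
    by do 2?[case: ifP => _]; rewrite ?rmorphN ?rmorph1 ?opprK ?rmorph0 ?subr0.
  do 2?[case: ifP => _];
    by rewrite mulr0n sub0r ?rmorphN ?rmorph1 ?opprK ?rmorph0 ?oppr0.
rewrite det_tridiag_mx_rec /=.
have -> := det_tridiag_corner K m.+1; have -> := det_tridiag_corner K m.
rewrite !fib_polySS; ring.
Qed.

(* With x = 2 i cos t, this is the identity U_(n-1)(cos t) sin t = sin (n t)
   for the Chebyshev polynomials of the second kind. *)
Lemma horner_fib_poly (R : realType) (t : R) (n : nat) :
  (fib_poly R[i] n).[2%:R * 'i * (cos t)%:C] * ('i * (sin t)%:C) =
    'i ^+ n * (sin (n%:R * t))%:C.
Proof.
set x := 2%:R * _ * _.
suff [] : (fib_poly R[i] n).[x] * ('i * (sin t)%:C) =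
            'i ^+ n * (sin (n%:R * t))%:C /\
          (fib_poly R[i] n.+1).[x] * ('i * (sin t)%:C) =
            'i ^+ n.+1 * (sin (n.+1%:R * t))%:C by [].
elim: n => [|n [IHn IHSn]].
  by rewrite fib_poly1 fib_poly0 horner0 hornerC !mul0r sin0 !mul1r expr1.
split=> //; rewrite fib_polySS hornerD hornerM hornerX mulrDl -mulrA IHSn IHn.
have i2 : 'i ^+ 2 = -1 :> R[i] := sqr_i R.
(* Sum of the addition formulas for $(n+1)t \pm t$. *)
have -> : sin (n.+2%:R * t) = 2 * cos t * sin (n.+1%:R * t) - sin (n%:R * t).
  have -> : n.+2%:R * t = n.+1%:R * t + t.
    by rewrite -[in LHS]addn1 natrD mulrDl mul1r.
  have -> : n%:R * t = n.+1%:R * t - t by rewrite -[n.+1]addn1 natrD; ring.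
  by rewrite sinD sinB; ring.
rewrite rmorphB !rmorphM /= rmorph_nat !exprS /x.
(* The sign $i^2 = -1$ reconciles the minus of the sine recurrence with the plus of the Fibonacci
   one. *)
transitivity ('i ^+ 2 * (2 * (cos t)%:C * 'i ^+ n * (sin (n.+1%:R * t))%:C)
              + 'i ^+ n * (sin (n%:R * t))%:C); first by ring.
rewrite [in RHS]mulrA -expr2 i2; ring.
Qed.

Theorem proposition1 (R : realType) (n : nat) (hn : (2 <= n)%N) :
  let theta : R := pi / n%:R in
  lists_eigenvalues (R_mx R[i] n)
    (0 :: [seq 2%:R * 'i * (cos (j%:R * theta))%:C | j <- index_iota 1 n]).
Proof.
move=> theta; set s := map _ _.
(* This factorization yields both the membership and the multiplicities. *)
suff charE : char_poly (R_mx R[i] n) = \prod_(z <- 0 :: s) ('X - z%:P).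
  move=> a; split.
    by rewrite eigenvalue_root_char charE root_prod_XsubC.
  by rewrite /algebraic_multiplicity charE mu_prod_XsubC.
have n_gt0 : (0 < n)%N by apply: leq_trans hn.
have theta_gt0 : 0 < theta by rewrite divr_gt0 ?pi_gt0 ?ltr0n.
have ntheta : n%:R * theta = pi by rewrite mulrC divfK // pnatr_eq0 -lt0n.
have jtheta j : (1 <= j < n)%N -> 0 < j%:R * theta < pi.
  by move=> /andP[j1 jn]; rewrite mulr_gt0 ?ltr0n // -ntheta ltr_pM2r // ltr_nat.
have i_neq0 : 'i != 0 :> R[i] by rewrite eq_complex /= oner_eq0 andbF.
have fibE : fib_poly R[i] n = \prod_(z <- s) ('X - z%:P).
  have /andP[mon /eqP sz] := monic_size_fib_poly R[i] n.-1.
  rewrite prednK // in mon sz.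
  rewrite [LHS](@all_roots_prod_XsubC _ _ s).
  - by rewrite (monicP mon) scale1r.
  - by rewrite sz size_map size_iota subn1 prednK.
  - apply/allP=> z /mapP[j]; rewrite mem_index_iota => j_in {z}->.
    apply/rootP; have := horner_fib_poly R (j%:R * theta) n.
    (* Here $\sin(n \cdot j\theta) = \sin(j\pi) = 0$ while $\sin(j\theta) \ne 0$, so the polynomial
       factor vanishes. *)
    rewrite (mulrCA n%:R) ntheta (mulr_natl pi) -[pi *+ j]add0r.
    rewrite (alternatingn (@sinDpi R)) sin0 !mulr0 => /eqP.
    rewrite mulf_eq0 => /orP[/eqP //|].
    rewrite mulf_eq0 (negbTE i_neq0) /= fmorph_eq0 gt_eqF //.
    by rewrite sin_gt0_pi // jtheta.
  (* The roots are distinct because cosine is injective on $[0, \pi]$, which contains every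
     $j\theta$. *)
  rewrite uniq_rootsE map_inj_in_uniq ?iota_uniq // => j k.
  rewrite !mem_index_iota => /jtheta j_in /jtheta k_in.
  move=> /mulfI; rewrite mulf_neq0 // ?pnatr_eq0 // => /(_ isT).
  move=> /complexI /cos_inj; rewrite !in_itv /=.
  move: j_in k_in => /andP[/ltW-> /ltW->] /andP[/ltW-> /ltW->] /(_ isT isT).
  by move=> /(mulIf (lt0r_neq0 theta_gt0)) /eqP; rewrite eqr_nat => /eqP.
case: n hn {n_gt0 theta_gt0 ntheta jtheta} @theta @s fibE => [|[|m]] //.
move=> _ theta s fibE.
by rewrite char_poly_R_mx big_cons subr0 fibE.
Qed.
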